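(* Let $\varepsilon>0$ and let $G$ be a nonempty graph with $\rho(G)\geq \exp(e/\varepsilon)$. If $k\in\mathbb{N}$ satisfies $1\leq k\leq \rho(G)/\ln\rho(G)$, then $G$ is $k$-DP-colorable with probability at most $\varepsilon$.
   Context: All graphs are finite and simple. $\mathbb{N}=\{0,1,2,\ldots\}$ and $[k]=\{1,\ldots,k\}$. The density of a nonempty graph $G$ is $d(G)=|E(G)|/|V(G)|$; the maximum density is $\rho(G)=\max_{G'} d(G')$, the maximum being over all nonempty subgraphs $G'$ of $G$. The letter $e$ in $\exp(e/\varepsilon)$ is the base of the natural logarithm $\ln$. A (DP-)cover of $G$ is a pair $\mathcal{H}=(L,H)$ where $H$ is a graph and $L:V(G)\to 2^{V(H)}$ is such that: $\{L(v):v\in V(G)\}$ is a partition of $V(H)$ into $|V(G)|$ independent sets; for each edge $uv\in E(G)$ the edges of $H$ between $L(u)$ and $L(v)$ form a matching; and $H$ has no other edges than those between $L(u)$ and $L(v)$ with $uv\in E(G)$. A transversal is a set $T\subseteq V(H)$ containing exactly one vertex of each $L(v)$; it is independent if it is an independent set in $H$. $G$ is $\mathcal{H}$-colorable if $\mathcal{H}$ has an independent transversal. For $k\in\mathbb{N}$, the random $k$-fold cover $\mathcal{H}(G,k)=(L,H)$ is defined by $L(v)=\{(v,i):i\in[k]\}$ for $v\in V(G)$ and, independently for each edge $uv\in E(G)$, the edges of $H$ between $L(u)$ and $L(v)$ form a perfect matching chosen uniformly at random among the $k!$ perfect matchings between $L(u)$ and $L(v)$ ($H$ has no other edges). We say $G$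 is $k$-DP-colorable with probability $p$ if $\mathbb{P}(G\text{ is }\mathcal{H}(G,k)\text{-colorable})=p$ (and similarly for ''at most'', ''at least'', ''less than''). *)

(* Defs.v *)
From HB Require Import structures.
From mathcomp Require Import all_boot all_order all_algebra.

Set Implicit Arguments.
Unset Strict Implicit.
Unset Printing Implicit Defensive.

Import Order.TTheory GRing.Theory Num.Theory.
Local Open Scope ring_scope.

Record sgraph := SGraph {
  vertex :> finType;
  adj : rel vertex;
  adj_sym : symmetric adj;
  adj_irrefl : irreflexive adj }.

Definition edges (G : sgraph) : {set {set G}} :=
  [set e | [exists x : G, exists y : G, adj x y && (e == [set x; y])]].

(* The pair (W, F) of a vertex set and an edge set is a subgraph of G,
   not necessarily an induced one. *)
Definition is_subgraph (G : sgraph) (S : {set G} * {set {set G}}) : bool :=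
  (S.2 \subset edges G) && [forall e in S.2, e \subset S.1].

Definition density (R : realFieldType) (G : sgraph)
    (S : {set G} * {set {set G}}) : R :=
  #|S.2|%:R / #|S.1|%:R.

(* Densities are nonnegative, so for nonempty G the default value 0 does not
   affect the maximum. *)
Definition max_density (R : realFieldType) (G : sgraph) : R :=
  \big[Num.max/0]_(S : {set G} * {set {set G}} |
      is_subgraph S && (S.1 != set0)) density R S.

Definition independent (G : sgraph) (A : {set G}) : bool :=
  [forall x in A, forall y in A, ~~ adj x y].

(* The data (L, H) of a cover of G; the axioms are in [is_DPcover]. *)
Record DPcover (G : sgraph) := MkDPcover {
  cgraph :> sgraph;
  clist : G -> {set cgraph} }.

(* The pairs {x, y} with x in A and y in B. *)
Definition crossing (T : finType) (A B : {set T}) : {set {set T}} :=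
  [set [set x; y] | x in A, y in B].

(* A matching is a set of pairwise disjoint edges ([trivIset]).  Empty lists
   are allowed in the first clause, as in the 0-fold cover. *)
Definition is_DPcover (G : sgraph) (C : DPcover G) : Prop :=
  [/\ forall x : C, exists! v : G, x \in clist C v,
      forall v : G, independent (clist C v),
      forall u v : G, adj u v ->
        trivIset (edges C :&: crossing (clist C u) (clist C v))
    & forall x y : C, adj x y ->
        exists u v : G, [/\ adj u v, x \in clist C u & y \in clist C v]].

Definition is_transversal (G : sgraph) (C : DPcover G) (T : {set C}) : bool :=
  [forall v : G, #|T :&: clist C v| == 1%N].

Definition colorable (G : sgraph) (C : DPcover G) : bool :=
  [exists T : {set C}, is_transversal T && independent T].

Definition perfect_matchings (T : finType) (A B : {set T}) :
    {set {set {set T}}} :=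
  [set M | partition M (A :|: B) & M \subset crossing A B].

Section RandomCover.
Variables (G : sgraph) (k : nat).

Definition fiber (v : G) : {set G * 'I_k} := [set x | x.1 == v].

Definition edge_of := {e : {set G} | e \in edges G}.

(* For e = {u, v}: the perfect matchings between the lists of u and v.  The
   two orderings of e give the same set. *)
Definition edge_matchings (e : edge_of) : {set {set {set G * 'I_k}}} :=
  [set M | [exists u : G, exists v : G, (val e == [set u; v]) &&
             (M \in perfect_matchings (fiber u) (fiber v))]].

(* An outcome assigns to every edge of G a set of pairs of vertices of H;
   only the families of perfect matchings have nonzero probability. *)
Definition outcome := {ffun edge_of -> {set {set G * 'I_k}}}.

Definition outcome_adj (w : outcome) : rel (G * 'I_k)%type :=
  fun x y => (x != y) && [exists e, [set x; y] \in w e].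

Lemma outcome_adj_sym w : symmetric (outcome_adj w).
Proof. by move=> x y; rewrite /outcome_adj eq_sym setUC. Qed.

Lemma outcome_adj_irrefl w : irreflexive (outcome_adj w).
Proof. by move=> x; rewrite /outcome_adj eqxx. Qed.

Definition outcome_graph (w : outcome) : sgraph :=
  SGraph (outcome_adj_sym w) (outcome_adj_irrefl w).

Definition outcome_cover (w : outcome) : DPcover G :=
  @MkDPcover G (outcome_graph w) fiber.

(* Product over the edges of the uniform distributions on the sets of perfect
   matchings. *)
Definition outcome_pmf (R : realFieldType) (w : outcome) : R :=
  \prod_(e : edge_of)
    if w e \in edge_matchings e then #|edge_matchings e|%:R^-1 else 0.

Definition prob_colorable (R : realFieldType) : R :=
  \sum_(w : outcome | colorable (outcome_cover w)) outcome_pmf R w.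

End RandomCover.

(* Main.v *)
Require Import Defs.
From mathcomp Require Import all_boot all_order all_algebra.
From mathcomp Require Import perm.
From mathcomp Require Import reals sequences exp.

(** The argument is a first-moment computation on a densest subgraph (W, F).

    An independent transversal picks a color f v in the list of every v, and
    for an edge uv the random matching must avoid the pair {(u, f u), (v, f v)}.
    Swapping two colors in the list of v permutes the perfect matchings, so all
    k possible partners of (u, f u) are equally likely and the matching avoids
    the chosen pair with probability at most 1 - 1/k
    ([perfect_matchings_pair], [edge_pmf_avoid]).  The matchings on distinct
    edges are independent, hence a fixed coloring of W survives all the edges of
    F with probability at most (1 - 1/k)^|F|, and a union bound over the k^|W|
    colorings of W gives ([prob_colorable_subgraph])

      P(colorable) <= k^|W| (1 - 1/k)^|F|.

    Put rho = |F| / |W|.  Since 1 - 1/k <= exp(-1/k) and k <= rho / ln rho, the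
    factor (1 - 1/k)^|F| is at most exp(- ln rho)^|W| = rho^(-|W|), so the bound
    is at most (k / rho)^|W| <= (1 / ln rho)^|W| ([union_bound_le]).  Finally
    1 / ln rho <= eps / e <= eps, and when eps < 1 the exponent |W| >= 1 only
    helps; when eps >= 1 there is nothing to prove. *)

Set Implicit Arguments.
Unset Strict Implicit.
Unset Printing Implicit Defensive.

Import Order.TTheory GRing.Theory Num.Theory.
Local Open Scope ring_scope.

(** * Perfect matchings between two disjoint sets *)

Section PerfectMatchings.
Variable T : finType.
Implicit Types A B : {set T}.

Lemma crossingC A B : crossing A B = crossing B A.
Proof.
apply/setP=> e; apply/imset2P/imset2P=> -[x y xA yB ->];
by exists y x; rewrite // setUC.
Qed.

Lemma perfect_matchingsC A B : perfect_matchings A B = perfect_matchings B A.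
Proof. by apply/setP=> M; rewrite !inE setUC crossingC. Qed.

Lemma set2_inj (x y u v : T) : [set u; v] = [set x; y] ->
  x = u /\ y = v \/ x = v /\ y = u.
Proof.
move=> E; have xuv : x \in [set u; v] by rewrite E set21.
have yuv : y \in [set u; v] by rewrite E set22.
have uxy : u \in [set x; y] by rewrite -E set21.
have vxy : v \in [set x; y] by rewrite -E set22.
case/set2P: xuv => xE; case/set2P: yuv => yE; [|by left|by right|]; subst x y.
  by case/set2P: vxy => ->; left.
by case/set2P: uxy => ->; left.
Qed.

Lemma perfect_matching_imset A B (s : {perm T}) M :
  s @: A = A -> s @: B = B -> M \in perfect_matchings A B ->
  [set s @: (C : {set T}) | C in M] \in perfect_matchings A B.
Proof.
move=> sA sB; rewrite !inE => /andP[pM /subsetP crM].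
have -> : partition [set s @: (C : {set T}) | C in M] (A :|: B).
  by rewrite -{1}sA -{1}sB -imsetU imset_partition //; exact: perm_inj.
apply/subsetP=> _ /imsetP[C /crM/imset2P[x y xA yB ->] ->].
apply/imset2P; exists (s x) (s y); rewrite ?imsetU ?imset_set1 //.
  by rewrite -sA imset_f.
by rewrite -sB imset_f.
Qed.

Lemma perfect_matching_partner A B a M : a \in A -> a \notin B ->
  M \in perfect_matchings A B -> exists2 b, b \in B & [set a; b] \in M.
Proof.
move=> aA aB; rewrite inE => /andP[/and3P[/eqP cM _ _] /subsetP crM].
have : a \in cover M by rewrite cM inE aA.
case/bigcupP=> C CM; have /imset2P[x y xA yB eC] := crM _ CM.
rewrite eC !inE => /orP[] /eqP aE; last by rewrite aE yB in aB.
by exists y; rewrite // aE -eC.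
Qed.

(** Every matching joins [a] to some element of [B], and the transposition of
    [b] and [c] injects the matchings joining [a] to [c] into those joining [a]
    to [b].  Hence the latter are at least the fraction 1/|B| of all. *)
Lemma perfect_matchings_pair A B a b :
  [disjoint A & B] -> a \in A -> b \in B ->
  (#|perfect_matchings A B| <=
   #|B| * #|[set M in perfect_matchings A B | [set a; b] \in M]|)%N.
Proof.
move=> dAB aA bB.
pose N c := [set M in perfect_matchings A B | [set a; c] \in M].
rewrite -/(N b).
have aNB : a \notin B by rewrite (disjointFr dAB).
have le_N c : c \in B -> (#|N c| <= #|N b|)%N.
  move=> cB; pose s := tperm b c.
  have sB x : x \in B -> s x \in B by rewrite /s; case: tpermP => // ->.
  have stabB : s @: B = B.
    apply/eqP; rewrite eqEcard card_imset ?leqnn ?andbT; last exact: perm_inj.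
    by apply/subsetP=> _ /imsetP[x xB ->]; exact: sB.
  have sA x : x \in A -> s x = x.
    move=> xA; have xB : x \notin B by rewrite (disjointFr dAB).
    by rewrite tpermD //; apply: contraNneq xB => <-.
  have stabA : s @: A = A by rewrite (eq_in_imset sA) imset_id.
  rewrite -(card_imset (N c) (imset_inj (imset_inj (@perm_inj _ s)))).
  apply/subset_leq_card/subsetP=> _ /imsetP[M + ->].
  rewrite !inE => /andP[MP acM].
  have := @perfect_matching_imset A B s M stabA stabB; rewrite !inE => -> //=.
  apply/imsetP; exists [set a; c] => //.
  by rewrite imsetU !imset_set1 sA // /s tpermR.
have sub : perfect_matchings A B \subset \bigcup_(c in B) N c.
  apply/subsetP=> M MP.
  have [c cB acM] := @perfect_matching_partner A B a M aA aNB MP.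
  by apply/bigcupP; exists c => //; rewrite inE MP.
apply: leq_trans (subset_leq_card sub) _.
rewrite -sum_nat_const; apply: leq_trans (leq_sum _ le_N).
elim/big_rec2: _ => [|c m S _ leS]; first by rewrite cards0.
by apply: leq_trans (leq_add (leqnn _) leS); rewrite cardsU leq_subr.
Qed.

End PerfectMatchings.

Lemma sum_indicator (R : pzRingType) (T : finType) (A : {set T}) (Q : pred T)
    (c : R) :
  \sum_(x | Q x) (if x \in A then c else 0) = #|[set x in A | Q x]|%:R * c.
Proof.
rewrite mulr_natl -sumr_const -big_mkcondr; apply: eq_bigl => x.
by rewrite inE andbC.
Qed.

Section RandomCoverBounds.
Variables (G : sgraph) (k : nat).

(** * The random matching on one edge *)

Lemma card_fiber (v : G) : #|fiber k v| = k.
Proof.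
have -> : fiber k v = [set (v, i) | i in 'I_k].
  apply/setP=> -[x i]; rewrite inE /=; apply/eqP/imsetP=> [->|[j _ [-> _]]//].
  by exists i.
by rewrite card_imset ?card_ord // => i j [].
Qed.

Lemma disjoint_fiber (u v : G) : u != v -> [disjoint fiber k u & fiber k v].
Proof.
move=> uv; rewrite -setI_eq0; apply/eqP/setP=> x; rewrite !inE.
by apply/andP=> -[/eqP-> /eqP vu]; rewrite vu eqxx in uv.
Qed.

Lemma edge_ofP (e : edge_of G) :
  exists2 p : G * G, adj p.1 p.2 & val e = [set p.1; p.2].
Proof.
case: e => e /=; rewrite inE => /existsP[x /existsP[y /andP[a /eqP->]]].
by exists (x, y).
Qed.

Lemma edge_matchingsE (e : edge_of G) u v : val e = [set u; v] ->
  edge_matchings k e = perfect_matchings (fiber k u) (fiber k v).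
Proof.
move=> eE; apply/setP=> M; rewrite inE; apply/existsP/idP; last first.
  by move=> MP; exists u; apply/existsP; exists v; rewrite eE eqxx.
case=> x /existsP[y /andP[/eqP]]; rewrite eE => /set2_inj[] [-> ->] //.
by rewrite perfect_matchingsC.
Qed.

(** For an edge [e] this is the pair of vertices of the cover which the coloring
    [f] picks above [e]; taking the image of [e] avoids choosing an order on its
    endpoints. *)
Definition selected (f : G -> 'I_k) (e : {set G}) : {set G * 'I_k} :=
  [set (x, f x) | x in e].

Lemma edge_matchings_selected (e : edge_of G) f :
  (#|edge_matchings k e| <=
   k * #|[set M in edge_matchings k e | selected f (val e) \in M]|)%N.
Proof.
have [[u v] /= uv eE] := edge_ofP e.
have uNv : u != v by apply: contraTneq uv => ->; rewrite adj_irrefl.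
rewrite (edge_matchingsE eE) eE /selected imsetU !imset_set1.
rewrite -[X in (_ <= X * _)%N](card_fiber v).
by apply: perfect_matchings_pair; rewrite ?disjoint_fiber // inE.
Qed.

Variable R : realFieldType.

Definition edge_pmf (e : edge_of G) (M : {set {set G * 'I_k}}) : R :=
  if M \in edge_matchings k e then #|edge_matchings k e|%:R^-1 else 0.

Lemma edge_pmf_ge0 e M : 0 <= edge_pmf e M.
Proof. by rewrite /edge_pmf; case: ifP => // _; rewrite invr_ge0. Qed.

Lemma edge_pmf_sum e (Q : pred {set {set G * 'I_k}}) :
  \sum_(M | Q M) edge_pmf e M =
  #|[set M in edge_matchings k e | Q M]|%:R / #|edge_matchings k e|%:R.
Proof. exact: sum_indicator. Qed.

Lemma edge_pmf_sum_le1 e Q : \sum_(M | Q M) edge_pmf e M <= 1.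
Proof.
rewrite edge_pmf_sum; have [->|n0] := eqVneq #|edge_matchings k e| 0%N.
  by rewrite invr0 mulr0.
rewrite ler_pdivrMr ?ltr0n ?lt0n // mul1r ler_nat subset_leq_card //.
by apply/subsetP=> M; rewrite inE => /andP[].
Qed.

(** Matchings containing the selected pair make up at least the fraction 1/k;
    when there is no perfect matching at all, the left-hand side is 0, which is
    why an inequality is stated. *)
Lemma edge_pmf_avoid (e : edge_of G) (f : G -> 'I_k) : (0 < k)%N ->
  \sum_(M : {set {set G * 'I_k}} | selected f (val e) \notin M) edge_pmf e M
    <= 1 - k%:R^-1.
Proof.
move=> k0; have kR : 0 < k%:R :> R by rewrite ltr0n.
rewrite edge_pmf_sum; have [->|n0] := eqVneq #|edge_matchings k e| 0%N.
  by rewrite invr0 mulr0 subr_ge0 invf_le1 // ler1n.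
rewrite ler_pdivrMr ?ltr0n ?lt0n // mulrBl mul1r lerBrDr -lerBrDl.
have := edge_matchings_selected e f.
set E := edge_matchings k e.
set P := fun M : {set _} => selected f (val e) \in M.
have -> : #|E| = (#|[set M in E | P M]| + #|[set M in E | ~~ P M]|)%N.
  rewrite -(cardsID [set M | P M] E); congr (_ + _)%N.
    by apply: eq_card => M; rewrite !inE.
  by apply: eq_card => M; rewrite !inE andbC.
by rewrite natrD addrK mulrC ler_pdivrMr // mulrC -natrD -natrM ler_nat.
Qed.

(** * Independence and the union bound *)

(** Independence of the edges, in the form needed here: expanding the product of
    the sums over the edges yields the sum over all outcomes. *)
Lemma prob_product_event (Q : edge_of G -> pred {set {set G * 'I_k}}) :
  \sum_(w : outcome G k | [forall e, Q e (w e)]) outcome_pmf R w =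
  \prod_e \sum_(M | Q e M) edge_pmf e M.
Proof.
under [RHS]eq_bigr do rewrite big_mkcond.
rewrite bigA_distr_bigA big_mkcond /=; apply: eq_bigr => w _.
case: ifP => [/forallP Qw|/negbT].
  by apply: eq_bigr => e _; rewrite Qw.
rewrite negb_forall => /existsP[e /negbTE nQ].
by rewrite (bigD1 e) //= nQ mul0r.
Qed.

Lemma outcome_pmf_ge0 w : 0 <= outcome_pmf (G:=G) (k:=k) R w.
Proof. by apply: prodr_ge0 => e _; exact: edge_pmf_ge0. Qed.

Lemma prob_colorable_le1 : prob_colorable G k R <= 1.
Proof.
apply: le_trans (_ : \sum_(w : outcome G k | [forall e, xpredT (w e)])
                       outcome_pmf R w <= 1).
  rewrite /prob_colorable big_mkcond [leRHS]big_mkcond; apply: ler_sum => w _.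
  have -> : [forall e, xpredT (w e)] by apply/forallP.
  by case: ifP => // _; exact: outcome_pmf_ge0.
rewrite (prob_product_event (fun _ => xpredT)).
apply: prodr_ile1 => e _.
by rewrite edge_pmf_sum_le1 sumr_ge0 // => M _; exact: edge_pmf_ge0.
Qed.

Lemma colorable_selection (w : outcome G k) : colorable (outcome_cover w) ->
  exists f : G -> 'I_k, forall e, selected f (val e) \notin w e.
Proof.
case/existsP=> T /andP[/forallP tr /forallP ind].
have fex v : exists i, (v, i) \in T.
  have := tr v; rewrite -[X in X == _]/(#|_|).
  move=> /cards1P[[x i]] /setP/(_ (x, i)).
  by rewrite !inE eqxx => /andP[xT /eqP /= <-]; exists i.
exists (fun v => xchoose (fex v)) => e; set f := fun v => _.
have fT v : (v, f v) \in T by exact: (xchooseP (fex v)).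
have [[u v] /= uv eE] := edge_ofP e.
have uNv : u != v by apply: contraTneq uv => ->; rewrite adj_irrefl.
have := ind (u, f u); rewrite fT /= => /forallP/(_ (v, f v)); rewrite fT /=.
rewrite /outcome_adj negb_and negbK xpair_eqE (negbTE uNv) /=.
rewrite negb_exists => /forallP/(_ e).
by rewrite eE /selected imsetU !imset_set1.
Qed.

(** Coloring the whole cover in particular colors the part of it above the
    subgraph, so only the colors on [S.1] and the edges in [S.2] enter the union
    bound. *)
Lemma prob_colorable_subgraph S : (0 < k)%N -> is_subgraph (G:=G) S ->
  prob_colorable G k R <= k%:R ^+ #|S.1| * (1 - k%:R^-1) ^+ #|S.2|.
Proof.
case: S => W F /= k0 /andP[/= /subsetP FE /forallP/= FW].
(* Colorings of W are encoded as colorings of G that take the default color i0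
   outside W, so that there are exactly k ^ #|W| of them. *)
pose i0 : 'I_k := Ordinal k0.
pose sel := [pred f : {ffun G -> 'I_k} | f \in pffun_on i0 (mem W) predT].
pose good (f : {ffun G -> 'I_k}) (e : edge_of G) (M : {set {set G * 'I_k}}) :=
  (val e \in F) ==> (selected f (val e) \notin M).
have union : prob_colorable G k R <=
    \sum_(f | sel f) \sum_(w : outcome G k | [forall e, good f e (w e)])
      outcome_pmf R w.
  under [leRHS]eq_bigr do rewrite big_mkcond.
  rewrite exchange_big /prob_colorable big_mkcond /=; apply: ler_sum => w _.
  have pos (f : {ffun G -> 'I_k}) :
      0 <= if [forall e, good f e (w e)] then outcome_pmf R w else 0.
    by case: ifP => // _; exact: outcome_pmf_ge0.
  case: ifP => [/colorable_selection[f fw]|_]; last by rewrite sumr_ge0.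
  pose g := [ffun v => if v \in W then f v else i0].
  have gsel : sel g.
    apply/pffun_onP; split=> [|x _ //]; apply/subsetP=> v.
    by rewrite !inE ffunE; case: (v \in W) => //; rewrite eqxx.
  rewrite (bigD1 g) //= ifT ?lerDl ?sumr_ge0 //.
  apply/forallP=> e; apply/implyP=> eF.
  suff -> : selected g (val e) = selected f (val e) by exact: fw.
  apply: eq_in_imset => v ve; rewrite ffunE.
  by have /implyP/(_ eF)/subsetP-> := FW (val e).
apply: le_trans union _.
apply: le_trans (_ : \sum_(f | sel f) (1 - k%:R^-1) ^+ #|F| <= _); last first.
  rewrite sumr_const -[X in _ *+ X]/#|pffun_on i0 (mem W) predT|.
  by rewrite card_pffun_on card_ord -[leLHS]mulr_natl natrX.
apply: ler_sum => f _; rewrite prob_product_event.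
apply: le_trans (_ : \prod_(e : edge_of G)
                       (if val e \in F then 1 - k%:R^-1 else 1) <= _).
  apply: ler_prod => e _.
  rewrite sumr_ge0 /=; last by move=> M _; exact: edge_pmf_ge0.
  rewrite /good; case: (val e \in F) => /=; first exact: edge_pmf_avoid.
  exact: edge_pmf_sum_le1.
rewrite -big_mkcond /= prodr_const.
suff -> : #|[pred e : edge_of G | val e \in F]| = #|F| by [].
rewrite -(card_imset _ val_inj); apply: eq_card => e; apply/imsetP/idP.
  by case=> e'; rewrite inE => + ->.
by move=> eF; exists (exist _ e (FE _ eF)).
Qed.

End RandomCoverBounds.

(** * Optimizing over the densest subgraph *)

Lemma max_density_attained (R : realFieldType) (G : sgraph) : (0 < #|G|)%N ->
  exists2 S, is_subgraph (G:=G) S && (S.1 != set0) &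
    max_density R G = density R S.
Proof.
case/card_gt0P=> v _.
have vP : is_subgraph (G:=G) ([set v], set0) && ([set v] != set0).
  rewrite /is_subgraph /= sub0set -card_gt0 cards1 andbT /=.
  by apply/forallP=> e; rewrite inE.
rewrite /max_density.
have ge0 S : is_subgraph (G:=G) S && (S.1 != set0) -> 0 <= density R S.
  by move=> _; rewrite divr_ge0.
have [S SP ->] :=
  Order.TotalTheory.eq_bigmax _ _ (density R (G:=G)) vP ge0.
by exists S.
Qed.

(** The hypothesis on [k] is equivalent both to exp(- rho / k) <= 1 / rho, which
    absorbs the factor from the edges, and to k / rho <= 1 / ln rho, which bounds
    what is left for each vertex. *)
Lemma union_bound_le (R : realType) (k n m : nat) (rho : R) : (0 < k)%N ->
  1 < rho -> m%:R = rho * n%:R -> k%:R <= rho / ln rho ->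
  k%:R ^+ n * (1 - k%:R^-1) ^+ m <= (ln rho)^-1 ^+ n.
Proof.
move=> k0 rho1 mE kle; have kR : 0 < k%:R :> R by rewrite ltr0n.
have rho0 : 0 < rho by apply: lt_trans rho1.
have ln0 : 0 < ln rho by rewrite ln_gt0.
have kge : 0 <= 1 - k%:R^-1 :> R by rewrite subr_ge0 invf_le1 ?ler1n.
have e1 : (1 - k%:R^-1) ^+ m <= expR (- ln rho) ^+ n.
  apply: le_trans (_ : expR (- k%:R^-1) ^+ m <= _).
    by rewrite lerXn2r ?nnegrE ?expR_ge0 // expR_ge1Dx.
  rewrite -!expRM_natl ler_expR mE !mulrN lerN2 [rho * _]mulrC -mulrA.
  by rewrite ler_wpM2l // ler_pdivlMr // mulrC -ler_pdivlMr.
apply: le_trans (ler_wpM2l _ e1) _; first by rewrite exprn_ge0 // ltW.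
rewrite -exprMn expRN lnK ?posrE // lerXn2r ?nnegrE //.
- by rewrite divr_ge0 ?ltW.
- by rewrite invr_ge0 ltW.
by rewrite ler_pdivrMr // mulrC.
Qed.

Theorem proposition1p1 (R : realType) (eps : R) (G : sgraph) (k : nat) :
  0 < eps ->
  (0 < #|G|)%N ->
  expR (expR 1 / eps) <= max_density R G ->
  (1 <= k)%N ->
  k%:R <= max_density R G / ln (max_density R G) ->
  prob_colorable G k R <= eps.
Proof.
move=> eps0 G0 rho_ge k0 k_le.
have [eps1|eps1] := leP 1 eps.
  exact: le_trans (prob_colorable_le1 _ _ _) eps1.
have [S /andP[subS S0] rhoE] := max_density_attained R G0.
rewrite rhoE in rho_ge k_le; set rho := density R S in rho_ge k_le.
have e_ge1 : 1 <= expR 1 :> R by rewrite -[leLHS]expR0 ler_expR.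
have ee0 : 0 < expR 1 / eps :> R by rewrite divr_gt0 ?expR_gt0.
have rho1 : 1 < rho.
  by apply: lt_le_trans rho_ge; rewrite -[ltLHS]expR0 ltr_expR.
have rho0 : 0 < rho by apply: lt_trans rho1.
have ln_ge : expR 1 / eps <= ln rho by rewrite -ler_expR lnK.
have ln0 : 0 < ln rho by apply: lt_le_trans ln_ge.
have inv_ln : (ln rho)^-1 <= eps.
  rewrite -[leRHS]invrK lef_pV2 ?posrE ?invr_gt0 //; apply: le_trans ln_ge.
  by rewrite ler_peMl // invr_ge0 ltW.
have n0 : (0 < #|S.1|)%N by rewrite card_gt0.
apply: le_trans (prob_colorable_subgraph R k0 subS) _.
apply: le_trans (union_bound_le k0 rho1 _ k_le) _.
  by rewrite /rho /density divfK // pnatr_eq0 -lt0n.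
have inv0 : 0 <= (ln rho)^-1 by rewrite invr_ge0 ltW.
exact: le_trans (ler_iXnr n0 inv0 (le_trans inv_ln (ltW eps1))) inv_ln.
Qed.
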